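(* Let $U = G'(5,2) = \{(i,i) : 1 \le i \le 5\} \cup \{(i,i+1) : 1 \le i \le 4\}$. Then for every integer $N \geq 5$ the set of typical coranks of $S = ([N]\times[N])\setminus U$ is exactly $\{2,3\}$. (In the paper's notation: $\mathrm{tc}(G'(5,2)^{\mathsf c}) = \{2,3\}$.)
   Context: $[N] = \{1,\ldots,N\}$. For $S \subseteq [N]\times[N]$ (the specified entries), a partial filling is a point $A \in \mathbb{R}^S$. A real completion of $A$ is a matrix $M \in \mathbb{R}^{N\times N}$ with $M_{ij} = A_{ij}$ for all $(i,j)\in S$. An integer $r$ is a typical rank of $S$ if there is a nonempty Euclidean open subset of $\mathbb{R}^S$ such that for every $A$ in it, the minimum rank among all real completions of $A$ equals $r$. The typical coranks of $S$ are the numbers $N - r$ with $r$ a typical rank of $S$. For a finite set $U$ of unspecified entries, $\mathrm{tc}(U^{\mathsf c})$ denotes the set of typical coranks of $([N]\times[N])\setminus U$, for any $N$ with $U \subseteq [N]\times[N]$ (this does not depend on $N$). *)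

(* Defs.v *)
From mathcomp Require Import all_boot all_order all_algebra.
From mathcomp Require Import all_classical all_reals all_analysis.

Set Implicit Arguments.
Unset Strict Implicit.
Unset Printing Implicit Defensive.

Import Order.TTheory GRing.Theory Num.Theory.
Import numFieldNormedType.Exports.

Local Open Scope classical_set_scope.
Local Open Scope ring_scope.

(* For finite [S] the product topology is the Euclidean topology on R^S. *)
Notation filling R S := {ptws {p | p \in S} -> R}.

Section MatrixCompletion.
Variables (R : realType) (N : nat).
Implicit Types (S : {set 'I_N * 'I_N}) (M : 'M[R]_N).

Definition is_completion S (A : filling R S) M : Prop :=
  forall p : {p | p \in S}, M (val p).1 (val p).2 = A p.

Definition is_min_completion_rank S (A : filling R S) (r : nat) : Prop :=
  (exists2 M, is_completion A M & \rank M = r) /\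
  (forall M, is_completion A M -> (r <= \rank M)%N).

Definition typical_rank S (r : nat) : Prop :=
  exists O : set (filling R S),
    [/\ open O, O !=set0 & forall A, O A -> is_min_completion_rank A r].

(* The truncated subtraction is exact, since a typical rank is at most N. *)
Definition typical_coranks S : set nat :=
  [set (N - r)%N | r in typical_rank S].

End MatrixCompletion.
Arguments typical_rank R {N} S r.
Arguments typical_coranks R {N} S.

(* Entries are numbered from 1, as in [N] = {1, ..., N}. *)
Definition Gprime52 : seq (nat * nat) :=
  [seq (i, i) | i <- iota 1 5] ++ [seq (i, i.+1) | i <- iota 1 4].

(* [N] x [N] minus U; the index i : 'I_N stands for i.+1 in {1, ..., N}. *)
Definition specified (N : nat) (U : seq (nat * nat)) : {set 'I_N * 'I_N} :=
  [set p : 'I_N * 'I_N | (p.1.+1, p.2.+1) \notin U].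

(* Main.v *)
Require Import Defs.
From mathcomp Require Import all_boot all_order all_algebra.
From mathcomp Require Import all_classical all_reals all_analysis.
From mathcomp Require Import ring lra zify.

(* A generic Schur complement removes the fully specified rows and columns, so
   only the 5 x 5 case matters.  Rank 3 can always be reached generically: put 0
   in four unspecified entries and write rows 1 and 2 as combinations of rows
   3, 4, 5.  A specified 2 x 2 minor forces rank at least 2.  Rank 2 means
   M_ij = <u_i, v_j> with vectors in the plane; after normalising v_1 and v_2,
   the specified entries determine u_3, u_4, u_5, v_3 and leave one parameter in
   each of u_1, u_2, v_4, v_5, tied by a 4-cycle of bilinear equations
   u_1 - v_4 - u_2 - v_5 - u_1.  Going around the cycle, the parameter t = M_44
   of v_4 must be a fixed point of a Moebius map, i.e. a root of a quadratic
   whose discriminant takes both signs on open sets. *)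

Set Implicit Arguments.
Unset Strict Implicit.
Unset Printing Implicit Defensive.

Import Order.TTheory GRing.Theory Num.Theory.
Import numFieldNormedType.Exports.

Local Open Scope ring_scope.
Local Open Scope classical_set_scope.

Lemma mxrank_leP (F : fieldType) (m n k : nat) (M : 'M[F]_(m, n)) :
  reflect (exists (P : 'M[F]_(m, k)) (Q : 'M[F]_(k, n)), M = P *m Q)
          (\rank M <= k)%N.
Proof.
apply: (iffP idP) => [leMk | [P [Q ->]]]; last first.
  exact: leq_trans (mulmx_max_rank P Q) (leqnn k).
exists (col_ebase M *m (pid_mx (\rank M) : 'M[F]_(m, k))).
exists ((pid_mx (\rank M) : 'M[F]_(k, n)) *m row_ebase M).
rewrite -mulmxA (mulmxA (pid_mx _)) mul_pid_mx minnn (minn_idPr leMk).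
by rewrite mulmxA mulmx_ebase.
Qed.

Lemma notin_Gprime52 (i j : nat) :
  (5 <= i)%N || (5 <= j)%N -> (i.+1, j.+1) \notin Gprime52.
Proof. by rewrite /Gprime52 /= !inE !xpair_eqE; lia. Qed.

Lemma in_Gprime52_lt (i j : nat) :
  (i.+1, j.+1) \in Gprime52 -> (i < 5)%N /\ (j < 5)%N.
Proof. by rewrite /Gprime52 /= !inE !xpair_eqE; lia. Qed.

(** * Completions of 5 x 5 partial matrices *)

Section FiveByFive.
Variable R : fieldType.
Implicit Types (a b : nat -> nat -> R) (i j : nat).

(* Entries of 5 x 5 matrices are indexed by natural numbers, from 0. *)
Definition mx5 a : 'M[R]_5 := \matrix_(i, j) a i j.

Definition agree_specified a b : Prop :=
  forall i j, (i < 5)%N -> (j < 5)%N -> (i.+1, j.+1) \notin Gprime52 ->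
    a i j = b i j.

Lemma rank_mx5_leP k a :
  (\rank (mx5 a) <= k)%N <->
  exists p q : nat -> nat -> R,
    forall i j, (i < 5)%N -> (j < 5)%N -> a i j = \sum_(l < k) p i l * q l j.
Proof.
split => [/mxrank_leP[P [Q defa]] | [p [q defa]]].
  (* [inord] needs an inhabited ordinal type, so k = 0 is treated apart. *)
  case: k P Q defa => [|k] P Q defa.
    exists (fun _ _ => 0), (fun _ _ => 0) => i j lti ltj.
    have /matrixP/(_ (Ordinal lti) (Ordinal ltj)) := defa.
    by rewrite !mxE /= !big_ord0.
  exists (fun i l => P (inord i) (inord l)), (fun l j => Q (inord l) (inord j)).
  move=> i j lti ltj; have /matrixP/(_ (inord i) (inord j)) := defa.
  rewrite !mxE !inordK // => ->.
  by apply: eq_bigr => l _; rewrite inord_val.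
apply/mxrank_leP; exists (\matrix_(i, l) p i l), (\matrix_(l, j) q l j).
apply/matrixP => i j; rewrite !mxE defa //.
by apply: eq_bigr => l _; rewrite !mxE.
Qed.

(** Rows 1 and 2 each have three specified entries, giving three linear equations for the
    coefficients on rows 3, 4, 5. Zeros in the unspecified entries of these three rows make the
    systems triangular: column 5 gives [c0], column 4 gives [c2], then [c1] comes from column 3 for
    row 1 and from column 1 for row 2. *)
Lemma rank_le3_completion a :
  a 2%N 4%N != 0 -> a 3%N 0%N != 0 -> a 3%N 2%N != 0 -> a 4%N 3%N != 0 ->
  exists2 b, agree_specified a b & (\rank (mx5 b) <= 3)%N.
Proof.
move=> a24 a30 a32 a43.
pose c0 i := a i 4%N / a 2%N 4%N.
pose c2 i := a i 3%N / a 4%N 3%N.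
pose c1 i :=
  if i is 0 then (a 0%N 2%N - c2 0%N * a 4%N 2%N) / a 3%N 2%N
  else (a 1%N 0%N - c0 1%N * a 2%N 0%N - c2 1%N * a 4%N 0%N) / a 3%N 0%N.
pose q (l j : nat) : R := nth 0 (nth [::]
  [:: [:: a 2%N 0%N; a 2%N 1%N; 0; 0; a 2%N 4%N];
      [:: a 3%N 0%N; a 3%N 1%N; a 3%N 2%N; 0; 0];
      [:: a 4%N 0%N; a 4%N 1%N; a 4%N 2%N; a 4%N 3%N; 0] ] l) j.
pose p (i l : nat) : R := nth 0 (nth [::]
  [:: [:: c0 0%N; c1 0%N; c2 0%N]; [:: c0 1%N; c1 1%N; c2 1%N];
      [:: 1; 0; 0]; [:: 0; 1; 0]; [:: 0; 0; 1] ] i) l.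
exists (fun i j => \sum_(l < 3) p i l * q l j); last first.
  by apply/rank_mx5_leP; exists p, q.
move=> [|[|[|[|[|i]]]]] [|[|[|[|[|j]]]]] // _ _ _;
  rewrite !big_ord_recl big_ord0 /p /q /= /c1 /c0 /c2; field;
  by rewrite ?a24 ?a30 ?a32 ?a43.
Qed.

Definition pivot a := a 3%N 0%N * a 4%N 1%N - a 3%N 1%N * a 4%N 0%N.

Lemma rank_ge2_pivot a b : agree_specified a b -> pivot a != 0 ->
  (2 <= \rank (mx5 b))%N.
Proof.
move=> ab; apply: contraNT; rewrite -ltnNge ltnS => /rank_mx5_leP[p [q defb]].
rewrite /pivot !ab // !defb // !big_ord_recl !big_ord0.
by apply/eqP; ring.
Qed.

End FiveByFive.

(** * The obstruction to rank 2 *)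

Section Obstruction.
Variable R : fieldType.
Implicit Types (a b : nat -> nat -> R) (t : R).

(* Let [M] be a rank 2 completion whose unspecified entry (4,4) is [t], with
   rows and columns numbered from 1 in this comment.  [pivot] is the minor on
   rows 4, 5 and columns 1, 2, and column j is
     (col_j x * column 1 + col_j y * column 2) / pivot.
   [row2y] is [M_22 * col4y], and [(col5x, col5y) / det23] solves the linear
   system given by the entries (2,5) and (3,5). *)
Definition col3x a := a 4%N 1%N * a 3%N 2%N - a 3%N 1%N * a 4%N 2%N.
Definition col3y a := a 3%N 0%N * a 4%N 2%N - a 4%N 0%N * a 3%N 2%N.
Definition col4x a t := a 4%N 1%N * t - a 3%N 1%N * a 4%N 3%N.
Definition col4y a t := a 3%N 0%N * a 4%N 3%N - a 4%N 0%N * t.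
Definition det34 a t := col3x a * col4y a t - col3y a * col4x a t.
Definition row2y a t := a 1%N 3%N * pivot a - a 1%N 0%N * col4x a t.
Definition det23 a t :=
  a 2%N 0%N * row2y a t - a 2%N 1%N * (a 1%N 0%N * col4y a t).
Definition col5x a t :=
  a 2%N 4%N * pivot a * row2y a t - a 2%N 1%N * (a 1%N 4%N * pivot a * col4y a t).
Definition col5y a t :=
  a 2%N 0%N * (a 1%N 4%N * pivot a * col4y a t)
  - a 2%N 4%N * pivot a * (a 1%N 0%N * col4y a t).

(* Row 1 pairs with columns 3, 4, 5 to the specified entries (1,3), (1,4), (1,5),
   so (col3, a_13), (col4, a_14), (col5, a_15) are linearly dependent; this is
   their determinant. *)
Definition obstruction a t :=
  (col3y a * a 0%N 3%N - a 0%N 2%N * col4y a t) * col5x a t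
  + (a 0%N 2%N * col4x a t - col3x a * a 0%N 3%N) * col5y a t
  + a 0%N 4%N * det34 a t * det23 a t.

(* The coefficients of the quadratic [obstruction a], interpolated at -1, 0, 1. *)
Definition obstr0 a := obstruction a 0.
Definition obstr1 a := (obstruction a 1 - obstruction a (-1)) / 2%:R.
Definition obstr2 a :=
  (obstruction a 1 + obstruction a (-1)) / 2%:R - obstruction a 0.

(** Each summand of [obstruction] contains exactly two factors affine in t, so interpolation at
    three points is exact. *)
Lemma obstructionE a t : 2%:R != 0 :> R ->
  obstruction a t = obstr2 a * t ^+ 2 + obstr1 a * t + obstr0 a.
Proof.
move=> nz2; rewrite /obstr2 /obstr1 /obstr0 /obstruction /col5x /col5y.
rewrite /det23 /row2y /det34 /col3x /col3y /col4x /col4y.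
by field.
Qed.

(** The denominators in [obstruction] are cleared, so substituting a rank 2 factorisation leaves a
    polynomial identity, valid for degenerate completions too. *)
Lemma rank_le2_obstruction a b : agree_specified a b ->
  (\rank (mx5 b) <= 2)%N -> obstruction a (b 3%N 3%N) = 0.
Proof.
move=> ab /rank_mx5_leP[p [q defb]].
have {}defb i j : (i < 5)%N -> (j < 5)%N ->
    b i j = p i 0%N * q 0%N j + p i 1%N * q 1%N j.
  by move=> lti ltj; rewrite defb // !big_ord_recl big_ord0 addr0.
rewrite /obstruction /col5x /col5y /det23 /row2y /det34.
rewrite /col3x /col3y /col4x /col4y /pivot !ab // !defb //.
by ring.
Qed.

(** With columns 1 and 2 normalised to the unit vectors, the factors are forced: rows 3, 4, 5 are
    read off these columns, columns 3 and 4 come from rows 4 and 5, row 2 is fitted to (2,1) and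
    (2,4), column 5 to (2,5) and (3,5), row 1 to (1,3) and (1,4). *)
Lemma rank_le2_completion a t : obstruction a t = 0 -> pivot a != 0 ->
  col4y a t != 0 -> det34 a t != 0 -> det23 a t != 0 ->
  exists2 b, agree_specified a b & (\rank (mx5 b) <= 2)%N.
Proof.
move=> Gt0 d0 y0 m0 mu0.
pose X := col5x a t / det23 a t.
pose Y := col5y a t / det23 a t.
pose p (i l : nat) : R := nth 0 (nth [::]
  [:: [:: pivot a * (a 0%N 2%N * col4y a t - a 0%N 3%N * col3y a) / det34 a t;
          pivot a * (a 0%N 3%N * col3x a - a 0%N 2%N * col4x a t) / det34 a t];
      [:: a 1%N 0%N; row2y a t / col4y a t];
      [:: a 2%N 0%N; a 2%N 1%N];
      [:: a 3%N 0%N; a 3%N 1%N];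
      [:: a 4%N 0%N; a 4%N 1%N] ] i) l.
pose q (l j : nat) : R := nth 0 (nth [::]
  [:: [:: 1; 0; col3x a / pivot a; col4x a t / pivot a; X / pivot a];
      [:: 0; 1; col3y a / pivot a; col4y a t / pivot a; Y / pivot a]] l) j.
exists (fun i j => \sum_(l < 2) p i l * q l j); last first.
  by apply/rank_mx5_leP; exists p, q.
have a04 : a 0%N 4%N = - ((col3y a * a 0%N 3%N - a 0%N 2%N * col4y a t) * X
  + (a 0%N 2%N * col4x a t - col3x a * a 0%N 3%N) * Y) / det34 a t.
  apply/eqP; rewrite -subr_eq0; apply/eqP.
  transitivity (obstruction a t / (det34 a t * det23 a t)).
    by rewrite /obstruction /X /Y; field; rewrite m0 mu0.
  by rewrite Gt0 mul0r.
move=> [|[|[|[|[|i]]]]] [|[|[|[|[|j]]]]] // _ _ _;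
  rewrite !big_ord_recl big_ord0 /p /q /= /bump /= ?a04
    ?addr0 ?mulr0 ?mulr1 ?add0r ?addr0 //.
- by move: m0; rewrite /det34 => m0; field; rewrite d0.
- by move: m0; rewrite /det34 => m0; field; rewrite d0.
- by field; rewrite d0.
- by rewrite /row2y; field; rewrite d0.
- by move: mu0; rewrite /X /Y /col5x /col5y /det23 => mu0; field; rewrite mu0 d0.
- by move: mu0; rewrite /X /Y /col5x /col5y /det23 => mu0; field; rewrite mu0 d0.
- by move: d0; rewrite /col3x /col3y /pivot => d0; field.
- by move: d0; rewrite /col3x /col3y /pivot => d0; field.
- by move: d0; rewrite /col4x /col4y /pivot => d0; field.
Qed.

End Obstruction.

(** * Real roots of the quadratic *)

Section RealCase.
Variable R : rcfType.
Implicit Types (a b : nat -> nat -> R) (t : R).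

Definition obstr_disc a := obstr1 a ^+ 2 - 4%:R * (obstr2 a * obstr0 a).
Definition obstr_root a :=
  (Num.sqrt (obstr_disc a) - obstr1 a) / (2%:R * obstr2 a).

Lemma obstruction_root a : 0 <= obstr_disc a -> obstr2 a != 0 ->
  obstruction a (obstr_root a) = 0.
Proof.
move=> /sqr_sqrtr discE g20.
rewrite obstructionE ?pnatr_eq0 // /obstr_root.
transitivity ((Num.sqrt (obstr_disc a) ^+ 2 - obstr_disc a) / (4%:R * obstr2 a)).
  by rewrite /obstr_disc; field.
by rewrite discE subrr mul0r.
Qed.

Lemma obstruction_neq0 a t : obstr_disc a < 0 -> obstruction a t != 0.
Proof.
apply: contraTneq => Gt0; rewrite -leNgt.
(* Completing the square in this form also covers [obstr2 a = 0]. *)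
suff -> : obstr_disc a = (2%:R * obstr2 a * t + obstr1 a) ^+ 2 by apply: sqr_ge0.
apply/eqP; rewrite -subr_eq0; apply/eqP.
transitivity (- 4%:R * obstr2 a * obstruction a t); last by rewrite Gt0 mulr0.
by rewrite obstructionE ?pnatr_eq0 // /obstr_disc; ring.
Qed.

(* Chosen so that [obstruction] is the quadratic - t^2 + (y - x - 1) t + 2 y. *)
Definition example (x y : R) : nat -> nat -> R := fun i j => nth 0 (nth [::]
  [:: [:: 0; 0; x; y; 1];
      [:: 1; 0; 0; 0; -1];
      [:: 1; 0; 0; 0; 1];
      [:: 1; 0; 1; 0; 0];
      [:: 0; 1; -1; 1; 0]] i) j.

Ltac unfold_obstr :=
  rewrite /obstr_disc /obstr_root /obstr2 /obstr1 /obstr0 /obstruction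
    /col5x /col5y /det23 /row2y /det34 /col3x /col3y /col4x /col4y /pivot
    /example /=.

Lemma obstr_disc_example x y :
  obstr_disc (example x y) = (1 - y + x) ^+ 2 + 8%:R * y.
Proof. by unfold_obstr; field. Qed.

Lemma obstr2_example x y : obstr2 (example x y) = -1.
Proof. by unfold_obstr; field. Qed.

Lemma obstr1_example x y : obstr1 (example x y) = y - x - 1.
Proof. by unfold_obstr; field. Qed.

End RealCase.

(** * Reduction to the 5 x 5 case *)

Section Schur.
Variables (F : fieldType) (n m : nat).
Implicit Types M : 'M[F]_(n + m).

(* The inverse of the lower right block is written with its adjugate to make
   continuity apparent. *)
Definition schur_mx M : 'M[F]_n :=
  ulsubmx M
  - ursubmx M *m ((\det (drsubmx M))^-1 *: \adj (drsubmx M)) *m dlsubmx M.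

Lemma rank_schur M : \det (drsubmx M) != 0 ->
  \rank M = (m + \rank (schur_mx M))%N.
Proof.
rewrite /schur_mx -{2}(submxK M).
move: (ulsubmx M) (ursubmx M) (dlsubmx M) (drsubmx M) => A B C D detD.
set Di := _ *: \adj D.
have DDi : D *m Di = 1%:M.
  by rewrite -scalemxAr mul_mx_adj scale_scalar_mx mulVf.
have DiD : Di *m D = 1%:M.
  by rewrite -scalemxAl mul_adj_mx scale_scalar_mx mulVf.
have unitU (X : 'M[F]_(n, m)) : block_mx 1%:M X 0 1%:M \in unitmx.
  by rewrite unitmxE det_ublock !det1 mulr1 unitr1.
have unitL (X : 'M[F]_(m, n)) : block_mx 1%:M 0 X 1%:M \in unitmx.
  by rewrite unitmxE det_lblock !det1 mulr1 unitr1.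
have -> : block_mx A B C D = block_mx 1%:M (B *m Di) 0 1%:M
    *m (block_mx (A - B *m Di *m C) 0 0 D *m block_mx 1%:M 0 (Di *m C) 1%:M).
  rewrite !mulmx_block !(mul1mx, mul0mx, mulmx0, mulmx1, addr0, add0r).
  by rewrite !mulmxA -(mulmxA B Di D) DiD mulmx1 DDi mul1mx subrK.
rewrite eqmxMfull ?row_full_unit // mxrankMfree ?row_free_unit //.
by rewrite rank_diag_block_mx addnC [\rank D]mxrank_unit // unitmxE unitfE.
Qed.

End Schur.

(** * Continuity and perturbation along lines *)

Section Continuity.
Variables (R : realType) (T : Type) (F : set_system T).
Context {FF : Filter F}.

Lemma cvg_det n (M : T -> 'M[R]_n) (L : 'M[R]_n) :
  (forall i j, M x i j @[x --> F] --> L i j) ->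
  \det (M x) @[x --> F] --> \det L.
Proof.
move=> cvgM_; apply: (cvg_big add_continuous) => s _.
apply: cvgM; first exact: cvg_cst.
by apply: (cvg_big mul_continuous) => i _.
Qed.

Lemma cvg_schur_mx n m (M : T -> 'M[R]_(n + m)) (L : 'M[R]_(n + m)) :
  (forall i j, M x i j @[x --> F] --> L i j) -> \det (drsubmx L) != 0 ->
  forall i j, schur_mx (M x) i j @[x --> F] --> schur_mx L i j.
Proof.
move=> cvgM_ detL i j.
under eq_cvg do rewrite !mxE; rewrite !mxE.
apply: cvgB; first exact: cvgM_.
apply: (cvg_big add_continuous) => l _.
under eq_cvg do rewrite !mxE; rewrite !mxE.
apply: cvgM; last exact: cvgM_.
apply: (cvg_big add_continuous) => k _.
under eq_cvg do rewrite !mxE; rewrite !mxE.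
apply: cvgM; first exact: cvgM_.
apply: cvgM.
  apply: cvgV => //; apply: cvg_det => ? ?.
  by under eq_cvg do rewrite !mxE; rewrite !mxE; apply: cvgM_.
apply: cvgM; first exact: cvg_cst.
apply: cvg_det => ? ?.
by under eq_cvg do rewrite !mxE; rewrite !mxE; apply: cvgM_.
Qed.

End Continuity.

Lemma nbhs_nonroot (R : realType) (p : {poly R}) (U : set R) :
  p != 0 -> nbhs (0 : R) U -> exists2 t, U t & p.[t] != 0.
Proof.
move=> p0 /nbhs_ballP[e /= e0 ballU].
(* The offset 2 keeps each point strictly inside the ball; [size p] distinct points are too many to
   be all roots of [p]. *)
pose pt k : R := e / k.+2%:R.
have /allPn[t /mapP[k _ ->] ptk] :
    ~~ all (root p) [seq pt k | k <- iota 0 (size p)].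
  apply/negP => roots; have := max_poly_roots p0 roots.
  rewrite size_map size_iota ltnn => h; suff : false by []; apply: h.
  rewrite map_inj_uniq ?iota_uniq // => k l /(mulfI (lt0r_neq0 e0)) /invr_inj.
  by move=> /eqP; rewrite eqr_nat => /eqP[].
exists (pt k) => //; apply: ballU.
rewrite /ball /= sub0r normrN gtr0_norm ?divr_gt0 ?ltr0n //.
by rewrite ltr_pdivrMr ?ltr0n // ltr_pMr // ltr1n.
Qed.

Lemma cvg_line (R : realType) (S : choiceType) (A E : {ptws S -> R}) :
  ((fun s => A s + t * E s) : {ptws S -> R}) @[t --> (0 : R)] --> A.
Proof.
apply/cvg_sup => s.
(* Evaluation at [s] is onto, as constant functions show, so only the values at [s] have to
   converge. *)
rewrite cvg_image; last by rewrite eqEsubset; split=> v // _; exists (cst v).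
have : A s + t * E s @[t --> (0 : R)] --> A s.
  rewrite -[X in _ --> X]addr0 -[X in _ --> _ + X](mul0r (E s)).
  apply: cvgD; first exact: cvg_cst.
  by apply: cvgM; [exact: cvg_id | exact: cvg_cst].
apply: cvg_trans => W /= AW.
exists ((fun g : {ptws S -> R} => g s) @^-1` W) => //.
by rewrite eqEsubset; split => [j [? + <-//]|j Wj]; exists (fun _ => j).
Qed.

Lemma cvg_eval (R : realType) (S : choiceType) (A : {ptws S -> R}) (s : S) :
  B s @[B --> A] --> A s.
Proof. exact: (@proj_continuous S (fun=> R) s A). Qed.

(** This serves as the density argument: a condition p(t) != 0 along one line through [A] can be met
    without leaving [O]. *)
Lemma open_line_nonroot (R : realType) (S : choiceType) (O : set {ptws S -> R})
    (A E : {ptws S -> R}) (p : {poly R}) :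
  open O -> O A -> p != 0 ->
  exists2 t, O (fun s => A s + t * E s) & p.[t] != 0.
Proof.
move=> oO OA p0; apply: (nbhs_nonroot p0).
by apply: (@cvg_line _ _ A E); exact: open_nbhs_nbhs.
Qed.

(** * Completions and Schur complements *)

Section Completion.
Variables (R : realType) (m : nat).
Notation spec := (specified (5 + m) Gprime52).
Implicit Types (A E : filling R spec) (M X : 'M[R]_(5 + m)).

(** The default 0 affects only the upper left 5 x 5 block; the other three blocks are those of every
    completion. *)
Definition filled A : 'M[R]_(5 + m) :=
  \matrix_(i, j) if insub (i, j) is Some p then A p else 0.

Lemma is_completionE A M : is_completion A M <->
  forall i j : 'I_(5 + m), (i.+1, j.+1) \notin Gprime52 -> M i j = filled A i j.
Proof.
split=> [compM i j ijG | compM [[i j] ijS]].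
  rewrite mxE; case: insubP => [p _ pE|]; last by rewrite inE ijG.
  by rewrite -compM pE.
rewrite /= compM; last by move: ijS; rewrite inE.
by rewrite mxE insubT.
Qed.

Definition coords (X : 'M[R]_5) (i j : nat) : R := X (inord i) (inord j).

Lemma mx5_coords (X : 'M[R]_5) : mx5 (coords X) = X.
Proof. by apply/matrixP => i j; rewrite mxE /coords !inord_val. Qed.

Definition schur A := coords (schur_mx (filled A)).

(** All completions share three blocks, so the Schur complement subtracts from the upper left block
    a matrix that depends on [A] alone. *)
Lemma completion_schur A M : \det (drsubmx (filled A)) != 0 ->
  is_completion A M ->
  exists2 b, agree_specified (schur A) b & \rank M = (m + \rank (mx5 b))%N.
Proof.
move=> detA /is_completionE compM.
have ur : ursubmx M = ursubmx (filled A).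
  apply/matrixP => i j; rewrite 4!mxE; apply: compM; apply: notin_Gprime52.
  by rewrite /= orbC.
have dl : dlsubmx M = dlsubmx (filled A).
  by apply/matrixP => i j; rewrite 4!mxE; apply: compM; apply: notin_Gprime52.
have dr : drsubmx M = drsubmx (filled A).
  by apply/matrixP => i j; rewrite 4!mxE; apply: compM; apply: notin_Gprime52.
exists (coords (schur_mx M)); last by rewrite mx5_coords rank_schur ?dr.
move=> i j lti ltj ijG; rewrite /schur /coords /schur_mx ur dl dr.
have MA : M (lshift m (inord i)) (lshift m (inord j)) =
          filled A (lshift m (inord i)) (lshift m (inord j)).
  by apply: compM; rewrite /= !inordK.
by rewrite !mxE MA !mxE.
Qed.

Lemma schur_completion A b : \det (drsubmx (filled A)) != 0 ->
  agree_specified (schur A) b ->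
  exists2 M, is_completion A M & \rank M = (m + \rank (mx5 b))%N.
Proof.
move=> detA agb.
(* The added difference is the term that the Schur complement subtracts. *)
pose M := block_mx (mx5 b + (ulsubmx (filled A) - schur_mx (filled A)))
  (ursubmx (filled A)) (dlsubmx (filled A)) (drsubmx (filled A)).
have scM : schur_mx M = mx5 b.
  rewrite {1}/schur_mx /M block_mxKul block_mxKur block_mxKdl block_mxKdr.
  by rewrite /schur_mx subKr addrK.
exists M; last by rewrite rank_schur ?scM // block_mxKdr.
apply/is_completionE => i j.
case: (split_ordP i) => i' ->; case: (split_ordP j) => j' -> ijG.
- rewrite block_mxEul [LHS]mxE [mx5 b _ _]mxE -agb // /schur /coords !inord_val.
  rewrite [X in _ + X]mxE [X in _ + (_ + X)]mxE addrC subrK.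
  by rewrite [LHS]mxE [LHS]mxE.
- by rewrite block_mxEur [LHS]mxE [LHS]mxE.
- by rewrite block_mxEdl [LHS]mxE [LHS]mxE.
- by rewrite block_mxEdr [LHS]mxE [LHS]mxE.
Qed.

End Completion.

(** * Continuity of the obstruction and its root *)

Section Limits.
Variables (R : realType) (T : Type) (F : set_system T).
Context {FF : Filter F}.
Variables (a : T -> nat -> nat -> R) (l : nat -> nat -> R).
Hypothesis cvg_a : forall i j, (i < 5)%N -> (j < 5)%N ->
  a x i j @[x --> F] --> l i j.

Ltac cvg_pol :=
  lazymatch goal with |- _ --> ?u =>
    lazymatch u with
    | (_ - _) => apply: cvgB; cvg_pol
    | (_ + _) => apply: cvgD; cvg_pol
    | (_ * _) => apply: cvgM; cvg_pol
    | l _ _ => exact: cvg_a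
    | _ => assumption
    end
  end.

Lemma cvg_pivot : pivot (a x) @[x --> F] --> pivot l.
Proof. by rewrite /pivot; cvg_pol. Qed.

Section Param.
Variables (t : T -> R) (tl : R).
Hypothesis cvg_t : t x @[x --> F] --> tl.

Lemma cvg_col4y : col4y (a x) (t x) @[x --> F] --> col4y l tl.
Proof. by rewrite /col4y; cvg_pol. Qed.

Lemma cvg_det34 : det34 (a x) (t x) @[x --> F] --> det34 l tl.
Proof. by rewrite /det34 /col3x /col3y /col4x /col4y; cvg_pol. Qed.

Lemma cvg_det23 : det23 (a x) (t x) @[x --> F] --> det23 l tl.
Proof. by rewrite /det23 /row2y /col4x /col4y /pivot; cvg_pol. Qed.

Lemma cvg_obstruction : obstruction (a x) (t x) @[x --> F] --> obstruction l tl.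
Proof.
rewrite /obstruction; apply: cvgD; last first.
  apply: cvgM; last exact: cvg_det23.
  by apply: cvgM; [exact: cvg_a | exact: cvg_det34].
by rewrite /col5x /col5y /row2y /col3x /col3y /col4x /col4y /pivot; cvg_pol.
Qed.

End Param.

Lemma cvg_obstr0 : obstr0 (a x) @[x --> F] --> obstr0 l.
Proof. by apply: cvg_obstruction; exact: cvg_cst. Qed.

Lemma cvg_obstr1 : obstr1 (a x) @[x --> F] --> obstr1 l.
Proof.
apply: cvgM; last exact: cvg_cst.
by apply: cvgB; apply: cvg_obstruction; exact: cvg_cst.
Qed.

Lemma cvg_obstr2 : obstr2 (a x) @[x --> F] --> obstr2 l.
Proof.
apply: cvgB; last by apply: cvg_obstruction; exact: cvg_cst.
apply: cvgM; last exact: cvg_cst.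
by apply: cvgD; apply: cvg_obstruction; exact: cvg_cst.
Qed.

Lemma cvg_obstr_disc : obstr_disc (a x) @[x --> F] --> obstr_disc l.
Proof.
rewrite /obstr_disc; under eq_cvg do rewrite expr2; rewrite expr2.
apply: cvgB; first by apply: cvgM; exact: cvg_obstr1.
apply: cvgM; first exact: cvg_cst.
by apply: cvgM; [exact: cvg_obstr2 | exact: cvg_obstr0].
Qed.

Lemma cvg_obstr_root : obstr2 l != 0 ->
  obstr_root (a x) @[x --> F] --> obstr_root l.
Proof.
move=> g20; apply: cvgM.
  apply: cvgB; last exact: cvg_obstr1.
  by apply: (continuous_cvg _ (@sqrt_continuous R _)); exact: cvg_obstr_disc.
apply: cvgV; first by rewrite mulf_neq0 ?pnatr_eq0.
by apply: cvgM; [exact: cvg_cst | exact: cvg_obstr2].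
Qed.

End Limits.

(** * Typical ranks *)

Section Typical.
Variables (R : realType) (m : nat).
Notation spec := (specified (5 + m) Gprime52).
Implicit Types (A E : filling R spec) (X : 'M[R]_(5 + m)).

Definition restrict X : filling R spec := fun s => X (val s).1 (val s).2.

Lemma filled_restrict X :
  (forall i j : 'I_(5 + m), (i.+1, j.+1) \in Gprime52 -> X i j = 0) ->
  filled (restrict X) = X.
Proof.
move=> X0; apply/matrixP => i j; rewrite mxE.
by case: insubP => [p _ pE|]; [rewrite /restrict pE | rewrite inE negbK => /X0].
Qed.

Lemma filled_line A E (t : R) :
  filled (fun s => A s + t * E s) = filled A + t *: filled E.
Proof.
apply/matrixP => i j; rewrite !mxE.
by case: insubP => // _; rewrite mulr0 addr0.
Qed.

Lemma filled_restrict_block (k : nat -> nat -> R) (D : 'M[R]_m) :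
  (forall i j, (i.+1, j.+1) \in Gprime52 -> k i j = 0) ->
  filled (restrict (block_mx (mx5 k) 0 0 D)) = block_mx (mx5 k) 0 0 D.
Proof.
move=> kU; apply: filled_restrict => i j ijG; have [] := in_Gprime52_lt ijG.
move: ijG; case: (split_ordP i) => i' -> //.
case: (split_ordP j) => j' -> // ijG _ _.
by rewrite block_mxEul mxE kU.
Qed.

Lemma min_completion_rank A r : \det (drsubmx (filled A)) != 0 ->
  (exists2 b, agree_specified (schur A) b & (\rank (mx5 b) <= r)%N) ->
  (forall b, agree_specified (schur A) b -> (r <= \rank (mx5 b))%N) ->
  is_min_completion_rank A (m + r).
Proof.
move=> detA [b ab ler] ger; split.
  have [M compM rM] := schur_completion detA ab.
  by exists M => //; rewrite rM; congr addn; apply/eqP; rewrite eqn_leq ler ger.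
move=> M compM; have [c ac ->] := completion_schur detA compM.
by rewrite leq_add2l ger.
Qed.

Lemma typical_rank_near A r :
  (\forall B \near A, is_min_completion_rank B r) -> typical_rank R spec r.
Proof.
move=> near_r; exists [set B | is_min_completion_rank B r]^°; split.
- exact: open_interior.
- by exists A.
- exact: interior_subset.
Qed.

Lemma example_unspec (x y : R) i j :
  (i.+1, j.+1) \in Gprime52 -> example x y i j = 0.
Proof.
by move=> ijG; have [] := in_Gprime52_lt ijG; move: ijG;
  case: i j => [|[|[|[|[|i]]]]] [|[|[|[|[|j]]]]].
Qed.

(** * Fillings near an example *)

Section Near.
Variables (T : Type) (F : set_system T).
Context {FF : Filter F}.
Variables (x y : R).
(** Zero off-diagonal blocks make the Schur complement equal to [example x y]. *)
Let A0 : filling R spec := restrict (block_mx (mx5 (example x y)) 0 0 1%:M).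
Variable B : T -> filling R spec.
Hypothesis cvg_B : forall s, B z s @[z --> F] --> A0 s.

Lemma cvg_filled i j : filled (B z) i j @[z --> F] --> filled A0 i j.
Proof.
case Es: (insub (i, j) : option {p | p \in spec}) => [p|].
  have fE A : filled A i j = A p by rewrite mxE Es.
  by under eq_cvg do rewrite fE; rewrite fE; exact: cvg_B.
have fE A : filled A i j = 0 by rewrite mxE Es.
by under eq_cvg do rewrite fE; rewrite fE; exact: cvg_cst.
Qed.

Lemma det_near : \forall z \near F, \det (drsubmx (filled (B z))) != 0.
Proof.
have detB : \det (drsubmx (filled (B z))) @[z --> F] -->
    \det (drsubmx (filled A0)).
  apply: cvg_det => i j.
  have E A : drsubmx (filled A) i j = filled A (rshift 5 i) (rshift 5 j).
    by rewrite [LHS]mxE [LHS]mxE.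
  by under eq_cvg do rewrite E; rewrite E; exact: cvg_filled.
apply: (cvgr_neq0 _ detB).
rewrite filled_restrict_block ?block_mxKdr ?det1 ?oner_eq0 //.
exact: example_unspec.
Qed.

Lemma cvg_schur i j : (i < 5)%N -> (j < 5)%N ->
  schur (B z) i j @[z --> F] --> example x y i j.
Proof.
move=> lti ltj.
have filledA0 := filled_restrict_block 1%:M (@example_unspec x y).
have -> : example x y i j = schur_mx (filled A0) (inord i) (inord j).
  rewrite filledA0 /schur_mx block_mxKul block_mxKur.
  by rewrite mul0mx mul0mx subr0 mxE !inordK.
apply: cvg_schur_mx => [? ?|]; first exact: cvg_filled.
by rewrite filledA0 block_mxKdr det1 oner_eq0.
Qed.

(** The discriminant stays negative nearby, which excludes rank 2, and the divisors of
    [rank_le3_completion] stay nonzero. *)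
Lemma near_rank3 : obstr_disc (example x y) < 0 ->
  \forall z \near F, is_min_completion_rank (B z) (m + 3).
Proof.
move=> disc0.
have near_disc : \forall z \near F, obstr_disc (schur (B z)) < 0.
  by apply: (cvgr_lt _ (cvg_obstr_disc cvg_schur)).
have near_neq0 i j : (i < 5)%N -> (j < 5)%N -> example x y i j != 0 ->
    \forall z \near F, schur (B z) i j != 0.
  by move=> lti ltj; apply: cvgr_neq0; exact: cvg_schur.
have near24 := near_neq0 2%N 4%N isT isT (oner_neq0 _).
have near30 := near_neq0 3%N 0%N isT isT (oner_neq0 _).
have near32 := near_neq0 3%N 2%N isT isT (oner_neq0 _).
have near43 := near_neq0 4%N 3%N isT isT (oner_neq0 _).
near=> z; apply: min_completion_rank; first by near: z; exact: det_near.
  by apply: rank_le3_completion; near: z.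
move=> b ab; rewrite ltnNge; apply/negP => /(rank_le2_obstruction ab)/eqP.
by apply/negP; apply: obstruction_neq0; near: z.
Unshelve. all: by end_near.
Qed.

(** The chosen root varies continuously with the filling, so the conditions of [rank_le2_completion]
    at that root persist. *)
Lemma near_rank2 : 0 < obstr_disc (example x y) ->
  col4y (example x y) (obstr_root (example x y)) != 0 ->
  det34 (example x y) (obstr_root (example x y)) != 0 ->
  det23 (example x y) (obstr_root (example x y)) != 0 ->
  \forall z \near F, is_min_completion_rank (B z) (m + 2).
Proof.
move=> disc0 v0 m0 mu0.
have g20 : obstr2 (example x y) != 0.
  by rewrite obstr2_example oppr_eq0 oner_eq0.
have d0 : pivot (example x y) != 0.
  by rewrite /pivot /= mulr1 mulr0 subr0 oner_eq0.
have root_cvg := cvg_obstr_root (FF := FF) cvg_schur g20.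
have near_disc : \forall z \near F, 0 < obstr_disc (schur (B z)).
  by apply: (cvgr_gt _ (cvg_obstr_disc cvg_schur)).
have near_g2 := cvgr_neq0 (FF := FF) _ (cvg_obstr2 (FF := FF) cvg_schur) g20.
have near_d := cvgr_neq0 (FF := FF) _ (cvg_pivot (FF := FF) cvg_schur) d0.
have near_v := cvgr_neq0 (FF := FF) _
  (cvg_col4y (FF := FF) cvg_schur root_cvg) v0.
have near_m := cvgr_neq0 (FF := FF) _
  (cvg_det34 (FF := FF) cvg_schur root_cvg) m0.
have near_mu := cvgr_neq0 (FF := FF) _
  (cvg_det23 (FF := FF) cvg_schur root_cvg) mu0.
near=> z.
have dz : pivot (schur (B z)) != 0 by near: z.
apply: min_completion_rank; first by near: z; exact: det_near.
  apply: (@rank_le2_completion _ _ (obstr_root (schur (B z)))) => //; last 3 first.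
  - by near: z.
  - by near: z.
  - by near: z.
  by apply: obstruction_root; [apply: ltW|]; near: z.
by move=> b ab; apply: (rank_ge2_pivot ab).
Unshelve. all: by end_near.
Qed.

End Near.

Lemma typical_rank3 : typical_rank R spec (m + 3).
Proof.
(* The discriminant (1 - y + x)^2 + 8 y is -8 at x = -2, y = -1. *)
apply: (typical_rank_near
  (A := restrict (block_mx (mx5 (example (-2) (-1))) 0 0 1%:M))).
apply: (@near_rank3 _ _ (@nbhs_filter _ _) (-2) (-1) id).
  by move=> s; exact: cvg_eval.
by rewrite obstr_disc_example; lra.
Qed.

Lemma typical_rank2 : typical_rank R spec (m + 2).
Proof.
apply: (typical_rank_near
  (A := restrict (block_mx (mx5 (example 1 1)) 0 0 1%:M))).
(* The quadratic is - t^2 - t + 2, with roots 1 and -2. At t = -2 the values of [col4y], [det34],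
   [det23] are 1, -1, 2. *)
have rootE : obstr_root (example 1 1) = -2%:R :> R.
  rewrite /obstr_root obstr_disc_example obstr1_example obstr2_example.
  have -> : (1 - 1 + 1) ^+ 2 + 8%:R * 1 = 3%:R ^+ 2 :> R by ring.
  by rewrite sqrtr_sqr ger0_norm ?ler0n //; field.
apply: (@near_rank2 _ _ (@nbhs_filter _ _) 1 1 id).
- by move=> s; exact: cvg_eval.
- by rewrite obstr_disc_example; lra.
- by rewrite rootE /col4y /example /=; lra.
- by rewrite rootE /det34 /col3x /col3y /col4x /col4y /example /=; lra.
- by rewrite rootE /det23 /row2y /col4x /col4y /pivot /example /=; lra.
Qed.

(* Positions whose perturbation makes the four divisors of [rank_le3_completion]
   and [pivot] nonzero. *)
Definition generic_dir (i j : nat) : R :=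
  ((i, j) \in [:: (2, 4); (3, 0); (3, 2); (4, 1); (4, 3)]%N)%:R.

Lemma generic_dir_unspec i j :
  (i.+1, j.+1) \in Gprime52 -> generic_dir i j = 0.
Proof.
by move=> ijG; have [] := in_Gprime52_lt ijG; move: ijG;
  case: i j => [|[|[|[|[|i]]]]] [|[|[|[|[|j]]]]].
Qed.

Lemma schur_generic_dir A t i j : (i < 5)%N -> (j < 5)%N ->
  schur (fun s => A s + t * restrict (block_mx (mx5 generic_dir) 0 0 0) s) i j =
  schur A i j + t * generic_dir i j.
Proof.
move=> lti ltj; rewrite /schur /coords filled_line.
rewrite (filled_restrict_block _ generic_dir_unspec).
rewrite -(submxK (filled A)) scale_block_mx !scaler0 add_block_mx !addr0.
rewrite /schur_mx !(block_mxKul, block_mxKur, block_mxKdl, block_mxKdr).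
by rewrite addrAC [LHS]mxE; congr (_ + _); rewrite !mxE !inordK.
Qed.

Lemma drsubmx_generic_dir A t :
  drsubmx (filled (fun s =>
    A s + t * restrict (block_mx (mx5 generic_dir) 0 0 0) s)) =
  drsubmx (filled A).
Proof.
rewrite filled_line (filled_restrict_block _ generic_dir_unspec).
rewrite -(submxK (filled A)) scale_block_mx !scaler0 add_block_mx !addr0.
by rewrite !block_mxKdr.
Qed.

(** Any nonempty open set contains a filling generic enough for both rank bounds to apply to its
    Schur complement, and its minimum rank is r. *)
Lemma typical_rank_bounds r : typical_rank R spec r -> (m + 2 <= r <= m + 3)%N.
Proof.
case=> W [oW [A WA] minW].
(* Perturb first the lower right block, to make it invertible, and then the
   specified entries of the upper left block, which shifts the Schur complement. *)
pose X1 : 'M[R]_(5 + m) := block_mx (mx5 (fun _ _ => 0)) 0 0 1%:M.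
(* The characteristic polynomial of -D at s is det (D + s I). *)
have [s WA1 ps] := open_line_nonroot (restrict X1) oW WA
  (monic_neq0 (char_poly_monic (- drsubmx (filled A)))).
move: WA1; set A1 := (X in W X) => WA1.
have det1 : \det (drsubmx (filled A1)) != 0.
  have -> : drsubmx (filled A1) = drsubmx (filled A) + s%:M.
    rewrite filled_line filled_restrict_block // -(submxK (filled A)).
    by rewrite scale_block_mx add_block_mx !block_mxKdr scalemx1.
  move: ps; rewrite -horner_evalE -det_map_mx; congr (\det _ != 0).
  apply/matrixP => i j; rewrite !mxE /= horner_evalE !hornerE.
  by case: eqP => _; rewrite ?mulr1n ?mulr0n ?hornerX ?horner0 opprK addrC.
pose a := schur A1.
(* The product of the four divisors and [pivot] of the Schur complement after a step t along
   [generic_dir]; entries (4,2) and (5,1) do not move. *)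
pose p : {poly R} := ('X + (a 2%N 4%N)%:P) * ('X + (a 3%N 2%N)%:P)
  * ('X + (a 4%N 3%N)%:P) * ('X + (a 3%N 0%N)%:P)
  * (('X + (a 3%N 0%N)%:P) * ('X + (a 4%N 1%N)%:P)
     - (a 3%N 1%N * a 4%N 0%N)%:P).
have p0 : p != 0.
  have Xc (c : R) : 'X + c%:P != 0.
    by rewrite -[c]opprK polyCN polyXsubC_eq0.
  rewrite /p !mulf_neq0 //; apply/eqP => q0.
  have h x : (x + a 3%N 0%N) * (x + a 4%N 1%N) - a 3%N 1%N * a 4%N 0%N = 0.
    by have := congr1 (horner^~ x) q0; rewrite !hornerE.
  (* The second difference of a monic quadratic is 2. *)
  by move: (h 0) (h 1) (h (-1)); lra.
have [t WA2 pt] := open_line_nonroot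
  (restrict (block_mx (mx5 generic_dir) 0 0 0)) oW WA1 p0.
move: WA2; set A2 := (X in W X) => WA2.
have det2 : \det (drsubmx (filled A2)) != 0.
  by rewrite /A2 drsubmx_generic_dir; exact: det1.
have aE i j : (i < 5)%N -> (j < 5)%N ->
    schur A2 i j = a i j + t * generic_dir i j.
  exact: schur_generic_dir.
move: pt; rewrite /p !hornerE !mulf_eq0 !negb_or.
move=> /andP[/andP[/andP[/andP[p24 p32] p43] p30] pd].
have [[M compM rM] minM] := minW _ WA2.
apply/andP; split.
  have [b ab rMb] := completion_schur det2 compM.
  rewrite -rM rMb leq_add2l; apply: (rank_ge2_pivot ab).
  by rewrite /pivot !aE // /generic_dir /= !(mulr1, mulr0, addr0) ![_ + t]addrC.
have [|||| b ab rb] := @rank_le3_completion _ (schur A2);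
  rewrite ?aE // /generic_dir /= ?mulr1 ?[_ + t]addrC //.
have [M' compM' rM'] := schur_completion det2 ab.
by apply: leq_trans (minM _ compM') _; rewrite rM' leq_add2l.
Qed.

End Typical.

Theorem proposition4p7 (R : realType) (N : nat) (hN : (5 <= N)%N) :
  typical_coranks R (specified N Gprime52) = [set 2%N; 3%N].
Proof.
have [m Nm] : exists m, N = (5 + m)%N by exists (N - 5)%N; lia.
subst N; apply/seteqP; split => [_ [r /typical_rank_bounds rm <-]|n].
  have [->|->] : r = (m + 2)%N \/ r = (m + 3)%N by lia.
    by right => /=; lia.
  by left => /=; lia.
case=> /= ->.
  by exists (m + 3)%N; [exact: typical_rank3 | lia].
by exists (m + 2)%N; [exact: typical_rank2 | lia].
Qed.
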